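(* Let $S$ be a regular ordered semigroup without zero element. Then the following two conditions are equivalent: (a) for every $a\in S$ and all $a',a''\in V_{\le}(a)$, $a'\,\mathcal{H}\,a''$; (b) for every $e,f\in E_{\le}(S)$ there is $x\in S$ such that $ef\le fxe$.
   Context: An ordered semigroup $(S,\cdot,\le)$ is a semigroup $(S,\cdot)$ that is a poset $(S,\le)$ such that $a\le b$ implies $ca\le cb$ and $ac\le bc$ for all $a,b,c\in S$. A zero element is an element $0$ with $0x=x0=0$ and $0\le x$ for all $x\in S$. For $H\subseteq S$, $(H]=\{t\in S: t\le h \text{ for some } h\in H\}$. $S$ is regular if $a\in(aSa]$ for every $a\in S$. The set of ordered idempotents is $E_{\le}(S)=\{e\in S: e\le e^2\}$. For $a\in S$, the set of inverses of $a$ is $V_{\le}(a)=\{b\in S: a\le aba \text{ and } b\le bab\}$. A nonempty $I\subseteq S$ is a left (right) ideal if $SI\subseteq I$ ($IS\subseteq I$) and $(I]\subseteq I$; $L(a)$ and $R(a)$ denote the smallest left and right ideals containing $a$. Green's relations: $a\,\mathcal{L}\,b$ iff $L(a)=L(b)$; $a\,\mathcal{R}\,b$ iff $R(a)=R(b)$; $\mathcal{H}=\mathcal{L}\cap\mathcal{R}$. *)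

(* Defs.v *)
From HB Require Import structures.
From mathcomp Require Import all_boot all_order.
From mathcomp Require Import boolp classical_sets.

Set Implicit Arguments.
Unset Strict Implicit.
Unset Printing Implicit Defensive.

Local Open Scope classical_set_scope.
Local Open Scope order_scope.
Local Open Scope group_scope.

(* The carrier is a choiceType with a boolean order; under the classical axioms
   of boolp (pselect, gen_choiceMixin) every semigroup with a Prop-valued
   compatible partial order carries such a structure. *)
HB.mixin Record isOrderedSemigroup d S of Order.POrder d S & Semigroup S := {
  le_mull : forall c a b : S, a <= b -> c * a <= c * b;
  le_mulr : forall c a b : S, a <= b -> a * c <= b * c
}.

#[short(type="orderedSemigroupType")]
HB.structure Definition OrderedSemigroup d :=
  { S of isOrderedSemigroup d S & Order.POrder d S & Semigroup S }.

Section OrderedSemigroupDefs.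
Context {d : Order.disp_t} {S : orderedSemigroupType d}.
Implicit Types (a b e z : S) (H I : set S).

Definition is_zero z : Prop := forall x : S, [/\ z * x = z, x * z = z & z <= x].

Definition down_closure H : set S := [set t | exists2 h, H h & t <= h].

Definition ordered_idempotents : set S := [set e | e <= e * e].

Definition inverses a : set S := [set b | a <= a * b * a /\ b <= b * a * b].

Definition left_ideal I : Prop :=
  [/\ I !=set0, [set s * i | s in [set: S] & i in I] `<=` I
    & down_closure I `<=` I].

Definition right_ideal I : Prop :=
  [/\ I !=set0, [set i * s | i in I & s in [set: S]] `<=` I
    & down_closure I `<=` I].

Definition principal_left_ideal a : set S := smallest left_ideal [set a].
Definition principal_right_ideal a : set S := smallest right_ideal [set a].

Definition green_L a b : Prop :=
  principal_left_ideal a = principal_left_ideal b.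
Definition green_R a b : Prop :=
  principal_right_ideal a = principal_right_ideal b.
Definition green_H a b : Prop := green_L a b /\ green_R a b.

(* [smallest] is an intersection; these confirm that it is itself an ideal. *)
Lemma principal_left_idealP a : left_ideal (principal_left_ideal a).
Proof.
split.
- by exists a => I [_]; apply.
- move=> _ [s _ [i Li <-]] I LI; have [[_ SI _] _] := LI; apply: SI.
  by exists s => //; exists i => //; apply: Li.
- move=> t [h Lh th] I LI; have [[_ _ dI] _] := LI; apply: dI.
  by exists h => //; apply: Lh.
Qed.

Lemma principal_right_idealP a : right_ideal (principal_right_ideal a).
Proof.
split.
- by exists a => I [_]; apply.
- move=> _ [i Ri [s _ <-]] I RI; have [[_ IS _] _] := RI; apply: IS.
  by exists i; [apply: Ri|exists s].
- move=> t [h Rh th] I RI; have [[_ _ dI] _] := RI; apply: dI.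
  by exists h => //; apply: Rh.
Qed.

End OrderedSemigroupDefs.

Definition regular_osemigroup {d : Order.disp_t} (S : orderedSemigroupType d)
    : Prop :=
  forall a : S, down_closure [set a * x * a | x in [set: S]] a.

Definition without_zero {d : Order.disp_t} (S : orderedSemigroupType d)
    : Prop :=
  ~ exists z : S, is_zero z.

(* Main.v *)
Require Import Defs.
From mathcomp Require Import all_boot all_order.
From mathcomp Require Import boolp classical_sets.

Import Order.POrderTheory.

Local Open Scope classical_set_scope.
Local Open Scope order_scope.
Local Open Scope group_scope.

(** The theorem is the ordered analogue of a familiar fact about regular
    semigroups: inverses are unique up to H exactly when ordered idempotents
    commute up to a middle factor.

    In a regular ordered semigroup the principal one-sided ideals are
    [R(a) = (aS]] and [L(a) = (Sa]], so Green's relations amount to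
    divisibility up to the order ([mem_principal_right_ideal], [green_RP] and
    their left versions).

    If idempotents commute up to a middle factor and [b], [c] are inverses of
    [a], then [ba] and [ca] are ordered idempotents, whence
    [b <= bab <= (ba)(ca)b <= (ca)x(ba)b], so that [b] lies in [R(c)]; the
    idempotents [ac] and [ab] give [b] in [L(c)] in the same way, and the roles
    of [b] and [c] can be exchanged.

    Conversely, for ordered idempotents [e], [f] and an inverse [z] of [ef],
    the element [g = fze] is again an inverse of [ef] and is itself an ordered
    idempotent ([inverses_sandwich]). Hence [g] and [ef] are both inverses of
    [g], so they are H-related by uniqueness. This puts [ef] below a right
    multiple of [f] and below a left multiple of [e], and [ef <= (ef)z(ef)]
    combines the two into [ef <= fxe]. *)

Section RegularOrderedSemigroup.
Context {d : Order.disp_t} {S : orderedSemigroupType d}.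
Implicit Types (a b c e f x z : S).

Lemma le_mul2 a b c x : a <= b -> c <= x -> a * c <= b * x.
Proof.
by move=> ab cx; apply: le_trans (le_mulr c _ _ ab) (le_mull b _ _ cx).
Qed.

(** * Ordered idempotents and inverses *)

Lemma inverses_sym {a b} : inverses a b -> inverses b a.
Proof. by case. Qed.

Lemma inverses_idem_l {a b} : inverses a b -> ordered_idempotents (a * b).
Proof. by case=> ha _; rewrite /ordered_idempotents /= mulgA; apply: le_mulr. Qed.

Lemma inverses_idem_r {a b} : inverses a b -> ordered_idempotents (b * a).
Proof. by move/inverses_sym/inverses_idem_l. Qed.

Lemma idem_self_inverse {e} : ordered_idempotents e -> inverses e e.
Proof.
by move=> he; split; apply: le_trans he (le_mulr e _ _ he).
Qed.

(** If [a <= axa], then [xax] is an inverse of [a]. *)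
Lemma regular_inverse (hreg : regular_osemigroup S) a :
  exists b, inverses a b.
Proof.
have [_ [x _ <-] hx] := hreg a; exists (x * a * x); split.
  apply: (le_trans hx); have := le_mulr (x * a) _ _ hx.
  by rewrite !mulgA.
apply: (@le_trans _ _ (x * (a * x * a) * x)).
  by apply: le_mulr; apply: le_mull.
have := le_mulr (x * a * x) _ _ (le_mull x _ _ hx).
by rewrite !mulgA.
Qed.

(** Multiplying an inverse of [ef] by [f] on the left and by [e] on the right
    keeps it an inverse, as [e] and [f] may be duplicated inside a product; and
    then [z <= z(ef)z] says that the result is an ordered idempotent. *)
Lemma inverses_sandwich e f z :
  ordered_idempotents e -> ordered_idempotents f -> inverses (e * f) z ->
  inverses (e * f) (f * z * e) /\ ordered_idempotents (f * z * e).
Proof.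
move=> he hf [h1 h2].
have idem : f * z * e <= f * z * e * (f * z * e).
  have := le_mulr e _ _ (le_mull f _ _ h2).
  by rewrite !mulgA.
split=> //; split.
  apply: le_trans h1 _.
  have := le_mul2 _ _ _ _ (le_mull e _ _ hf) (le_mull z _ _ (le_mulr f _ _ he)).
  by rewrite !mulgA.
apply: le_trans idem _.
have := le_mul2 _ _ _ _ (le_mull (f * z) _ _ he)
                        (le_mulr e _ _ (le_mulr z _ _ hf)).
by rewrite !mulgA.
Qed.

(** * Green's relations as divisibility up to the order *)

(** Regularity is what allows the generator [a] itself to be a multiple of [a]
    up to the order, so that [(aS]] is an ideal containing [a]. *)
Lemma mem_principal_right_ideal (hreg : regular_osemigroup S) a b :
  principal_right_ideal a b <-> exists x, b <= a * x.
Proof.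
split=> [|[x bax]]; last first.
  have [_ RS dR] := principal_right_idealP a.
  apply: dR; exists (a * x) => //; apply: RS.
  by exists a; [move=> I [_]; apply | exists x].
have [_ [y _ <-] ay] := hreg a.
have aa : a <= a * (y * a) by rewrite mulgA.
move=> /(_ [set t | exists x, t <= a * x]).
apply; split; last by move=> _ ->; exists (y * a).
split.
- by exists a; exists (y * a).
- move=> _ [i [x ix] [s _ <-]]; exists (x * s).
  by rewrite mulgA; apply: le_mulr.
- by move=> t [h [x hx] th]; exists x; apply: (le_trans th hx).
Qed.

Lemma mem_principal_left_ideal (hreg : regular_osemigroup S) a b :
  principal_left_ideal a b <-> exists x, b <= x * a.
Proof.
split=> [|[x bxa]]; last first.
  have [_ SL dL] := principal_left_idealP a.
  apply: dL; exists (x * a) => //; apply: SL.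
  by exists x => //; exists a => // I [_]; apply.
have [_ [y _ <-] ay] := hreg a.
move=> /(_ [set t | exists x, t <= x * a]).
apply; split; last by move=> _ ->; exists (a * y).
split.
- by exists a; exists (a * y).
- move=> _ [s _ [i [x ix] <-]]; exists (s * x).
  by rewrite -mulgA; apply: le_mull.
- by move=> t [h [x hx] th]; exists x; apply: (le_trans th hx).
Qed.

Lemma green_RP (hreg : regular_osemigroup S) a b :
  green_R a b <-> (exists x, a <= b * x) /\ (exists y, b <= a * y).
Proof.
split=> [ab | [[x ax] [y by_]]].
  by split; apply/(mem_principal_right_ideal hreg);
    [rewrite -ab | rewrite ab] => I [_]; apply.
apply/seteqP; split=> t /(mem_principal_right_ideal hreg) [s ts];
  apply/(mem_principal_right_ideal hreg).
  by exists (x * s); rewrite mulgA; apply: le_trans ts (le_mulr s _ _ ax).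
by exists (y * s); rewrite mulgA; apply: le_trans ts (le_mulr s _ _ by_).
Qed.

Lemma green_LP (hreg : regular_osemigroup S) a b :
  green_L a b <-> (exists x, a <= x * b) /\ (exists y, b <= y * a).
Proof.
split=> [ab | [[x ax] [y by_]]].
  by split; apply/(mem_principal_left_ideal hreg);
    [rewrite -ab | rewrite ab] => I [_]; apply.
apply/seteqP; split=> t /(mem_principal_left_ideal hreg) [s ts];
  apply/(mem_principal_left_ideal hreg).
  by exists (s * x); rewrite -mulgA; apply: le_trans ts (le_mull s _ _ ax).
by exists (s * y); rewrite -mulgA; apply: le_trans ts (le_mull s _ _ by_).
Qed.

(** * Commutation of idempotents and comparison of inverses *)

Definition idempotents_quasicommute :=
  forall e f : S, ordered_idempotents e -> ordered_idempotents f ->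
    exists x : S, e * f <= f * x * e.

(** [b <= bab <= (ba)(ca)b], and the idempotents [ba] and [ca] can be swapped,
    which brings [c] to the front. *)
Lemma inverses_le_right (hcomm : idempotents_quasicommute) {a b c} :
  inverses a b -> inverses a c -> exists x, b <= c * x.
Proof.
move=> hb hc; have [_ hbab] := hb; have [haca _] := hc.
have [x hx] := hcomm _ _ (inverses_idem_r hb) (inverses_idem_r hc).
exists (a * x * (b * a) * b); apply: le_trans hbab _.
have h1 := le_mulr b _ _ (le_mull b _ _ haca).
have h2 := le_mulr b _ _ hx.
by move: h1 h2; rewrite !mulgA; apply: le_trans.
Qed.

Lemma inverses_le_left (hcomm : idempotents_quasicommute) {a b c} :
  inverses a b -> inverses a c -> exists x, b <= x * c.
Proof.
move=> hb hc; have [_ hbab] := hb; have [haca _] := hc.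
have [x hx] := hcomm _ _ (inverses_idem_l hc) (inverses_idem_l hb).
exists (b * (a * b) * x * a); apply: le_trans hbab _.
have h1 := le_mulr b _ _ (le_mull b _ _ haca).
have h2 := le_mull b _ _ hx.
by move: h1 h2; rewrite !mulgA; apply: le_trans.
Qed.

End RegularOrderedSemigroup.

Theorem theorem3p10 (d : Order.disp_t) (S : orderedSemigroupType d)
    (hreg : regular_osemigroup S) (hzero : without_zero S) :
  (forall a a' a'' : S, inverses a a' -> inverses a a'' -> green_H a' a'') <->
  (forall e f : S, ordered_idempotents e -> ordered_idempotents f ->
     exists x : S, e * f <= f * x * e).
Proof.
split=> [huniq e f he hf | hcomm a b c hb hc].
  have [z hz] := regular_inverse hreg (e * f).
  have [hg gidem] := inverses_sandwich _ _ _ he hf hz.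
  have [] := huniq _ _ _ (inverses_sym hg) (idem_self_inverse gidem).
  move=> /(green_LP hreg)[[v hv] _] /(green_RP hreg)[[u hu] _].
  (* [ef <= (ef)z(ef)], with [u] used for the left factor, [v] for the right *)
  exists (z * e * u * z * (v * f * z)).
  have [hz1 _] := hz; apply: le_trans hz1 _.
  have := le_mul2 _ _ _ _ (le_mulr z _ _ hu) hv.
  by rewrite !mulgA.
split.
  by apply/(green_LP hreg); split; apply: (inverses_le_left hcomm (a := a)).
by apply/(green_RP hreg); split; apply: (inverses_le_right hcomm (a := a)).
Qed.
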